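(* Let $\mathcal{G}$ be an $n$-dimensional real solvable Lie algebra ($n\ge 4$) whose derived ideal satisfies $\mathcal{G}^1\cong\mathbb{R}^{n-2}$ (i.e. $\mathcal{G}^1$ is commutative of dimension $n-2$) and such that $\dim\mathcal{A}_{\mathcal{G}}=1$. Then one can always choose two linearly independent elements $Y,Z\in\mathcal{G}\setminus\mathcal{G}^1$ such that $a_Y=0\ne a_Z$ and $\mathcal{A}_{\mathcal{G}}=\mathrm{Span}\{a_Z\}$. Furthermore, the following assertions hold. (1) If $[Y,Z]=0$ or $a_Z$ is non-singular, then $\mathcal{G}$ is decomposable; namely $\mathcal{G}\cong\mathbb{R}\oplus\bar{\mathcal{G}}$, where $\bar{\mathcal{G}}$ is an $(n-1)$-dimensional real solvable Lie algebra with $(n-2)$-dimensional derived ideal $\bar{\mathcal{G}}^1=[\bar{\mathcal{G}},\bar{\mathcal{G}}]=\mathcal{G}^1$. (2) If $[Y,Z]\neq 0$ and $a_Z$ is singular, then $\mathcal{G}$ is indecomposable. Moreover, the Lie structure of $\mathcal{G}$ is completely determined by $[Z,Y]$ and the operator $a_Z$. In this case one can always choose a basis $(X_1,\ldots,X_{n-2})$ of $\mathcal{G}^1$ such that $[Z,Y]=X_{n-2}$, $\mathrm{rank}(a_Z)=n-3$ and the matrix of $a_Z$ is $$a_Z=\bar{A}\in\left\{\begin{bmatrix}A&0\\0&0\end{bmatrix},\ \begin{bmatrix}0&A\\0&0\end{bmatrix}\ \Big|\ A\in\mathrm{GL}_{n-3}(\mathbb{R})\right\}.$$ In addition, two $(n-2)$-square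 real matrices $\bar{A},\bar{B}$ of this form define isomorphic Lie structures if and only if $\bar{A}\sim_p\bar{B}$.
   Context: For a real Lie algebra $\mathcal{G}$ and $X\in\mathcal{G}$: $\mathcal{G}^1:=[\mathcal{G},\mathcal{G}]$, $a_X:=\mathrm{ad}_X|_{\mathcal{G}^1}$ is the restriction of $\mathrm{ad}_X$ to $\mathcal{G}^1$, and $\mathcal{A}_{\mathcal{G}}:=\mathrm{Span}\{a_X : X\in\mathcal{G}\}$. A Lie algebra is decomposable if it is the (Lie algebra) direct sum of two non-trivial subalgebras, and indecomposable otherwise. The operator $a_Z$ is identified with its matrix in the basis $(X_1,\ldots,X_{n-2})$ of $\mathcal{G}^1$ (the $j$-th column gives the coordinates of $[Z,X_j]$). The Lie structure defined by $\bar{A}$ (one of the $(n-2)$-square matrices in the displayed set; the zero blocks have the sizes making the matrix $(n-2)\times(n-2)$ with $A$ in the upper left, respectively upper right, corner) is the Lie algebra with basis $(X_1,\ldots,X_{n-2},Y,Z)$ whose only possibly non-zero brackets of basis vectors are $[Z,Y]=X_{n-2}$ and those given by $[Z,X_j]=\sum_i \bar{A}_{ij}X_i$. Two matrices $A,B\in\mathrm{Mat}_m(\mathbb{R})$ are proportional similar, $A\sim_p B$, if there exist $c\in\mathbb{R}\setminus\{0\}$ and $C\in\mathrm{GL}_m(\mathbb{R})$ with $cA=C^{-1}BC$.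
   Formalization: In (2), the basis with [Z,Y]=X_{n-2} and a_Z in normal form is obtained after replacing Y by some Y' in Y+G^1, again admissible with Z; for fixed Y it fails, e.g. n=4, [Z,X_1]=X_1, [Z,X_2]=0, [Z,Y]=X_1+X_2. *)

(* Defs.v *)
From HB Require Import structures.
From mathcomp Require Import all_boot all_order all_algebra ring.
From mathcomp Require Import reals.

Set Implicit Arguments.
Unset Strict Implicit.
Unset Printing Implicit Defensive.

Import Order.TTheory GRing.Theory Num.Theory.
Local Open Scope ring_scope.

HB.mixin Record Vector_isLie (K : fieldType) L of Vector K L := {
  lie : L -> L -> L;
  lie_linearr : forall x : L, linear (lie x);
  lie_linearl : forall y : L, linear (fun x => lie x y);
  lie_alternating : forall x : L, lie x x = 0;
  lie_jacobi : forall x y z : L,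
    lie x (lie y z) + lie y (lie z x) + lie z (lie x y) = 0
}.

#[short(type="lieAlgType")]
HB.structure Definition LieAlgebra (K : fieldType) :=
  { L of Vector_isLie K L & Vector K L }.

Section LieTheory.
Variables (K : fieldType) (L : lieAlgType K).
Implicit Types (x y z : L) (U V W : {vspace L}).

HB.instance Definition _ x :=
  GRing.isLinear.Build K L L *:%R (lie x) (@lie_linearr K L x).

Lemma lieNC x y : lie y x = - lie x y.
Proof.
have Dl (a b c : L) : lie (a + b) c = lie a c + lie b c.
  by have := @lie_linearl K L c 1 a b; rewrite !scale1r.
have := @lie_alternating K L (x + y).
rewrite Dl !raddfD /= !lie_alternating add0r addr0 => /eqP.
by rewrite addrC addr_eq0 => /eqP.
Qed.

Definition lie_prod U V : {vspace L} :=
  <<[seq lie u v | u <- (vbasis U : seq L), v <- (vbasis V : seq L)]>>%VS.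

Lemma lie_prodP U V W :
  reflect {in U & V, forall u v, lie u v \in W} (lie_prod U V <= W)%VS.
Proof.
apply: (iffP idP) => [sW u v uU vV|H]; last first.
  apply/span_subvP => _ /allpairsP[[u v] /= [uU vV ->]].
  by apply: H; apply: vbasis_mem.
rewrite (coord_vbasis uU).
have Ef x : lie x v = - lie v x by rewrite lieNC.
rewrite Ef linear_sum -sumrN; apply: rpred_sum => i _.
rewrite linearZ /= -scalerN -Ef; apply: rpredZ.
rewrite (coord_vbasis vV) linear_sum; apply: rpred_sum => j _.
rewrite linearZ; apply: rpredZ; apply: (subvP sW); apply: memv_span.
by apply/allpairsP; exists ((vbasis U)`_i, (vbasis V)`_j);
  split=> //=; apply: mem_nth; rewrite size_tuple.
Qed.

Definition derived U : {vspace L} := lie_prod U U.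

Definition derived_series (k : nat) U : {vspace L} := iter k derived U.

Definition lie_solvable U : Prop := exists k, derived_series k U = 0%VS.

Definition lie_commutative U : Prop := {in U &, forall u v, lie u v = 0}.

Record subalgebra := Subalgebra {
  subalgebra_vs :> {vspace L};
  _ : (lie_prod subalgebra_vs subalgebra_vs <= subalgebra_vs)%VS
}.

Lemma lie_subalgebra (H : subalgebra) :
  {in (H : {vspace L}) &, forall u v, lie u v \in (H : {vspace L})}.
Proof. by case: H => H /= /lie_prodP. Qed.

(* Direct sum as Lie algebras: the two summands also commute with each other. *)
Definition lie_direct_sum (H1 H2 : subalgebra) : Prop :=
  [/\ (H1 + H2)%VS = {:L}%VS, (H1 :&: H2)%VS = 0%VS
    & {in (H1 : {vspace L}) & (H2 : {vspace L}), forall u v, lie u v = 0}].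

Definition decomposable : Prop :=
  exists H1 H2 : subalgebra,
    [/\ (H1 : {vspace L}) <> 0%VS, (H2 : {vspace L}) <> 0%VS
      & lie_direct_sum H1 H2].

End LieTheory.

Arguments decomposable {K} L.
Arguments subalgebra {K} L.

Definition lie_isomorphism (K : fieldType) (L1 L2 : lieAlgType K)
    (f : {linear L1 -> L2}) : Prop :=
  bijective f /\ {morph f : x y / lie x y}.

Definition lie_isomorphic (K : fieldType) (L1 L2 : lieAlgType K) : Prop :=
  exists f : {linear L1 -> L2}, lie_isomorphism f.

Section SubLie.
Variables (K : fieldType) (L : lieAlgType K) (H : subalgebra L).

Definition sub_lie (u v : subvs_of H) : subvs_of H :=
  vsproj H (lie (vsval u) (vsval v)).

Lemma vsval_sub_lie u v : vsval (sub_lie u v) = lie (vsval u) (vsval v).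
Proof. by rewrite /sub_lie vsprojK // lie_subalgebra // subvsP. Qed.

Fact sub_lie_linearr u : linear (sub_lie u).
Proof.
move=> a v w; apply: subvs_inj.
by rewrite [RHS]linearP /= !vsval_sub_lie [vsval (_ + _)]linearP [LHS]linearP.
Qed.

Fact sub_lie_linearl v : linear (fun u => sub_lie u v).
Proof.
move=> a u w; apply: subvs_inj.
rewrite [RHS]linearP /= !vsval_sub_lie [vsval (_ + _)]linearP.
exact: lie_linearl.
Qed.

Fact sub_lie_alternating u : sub_lie u u = 0.
Proof. by apply: subvs_inj; rewrite vsval_sub_lie lie_alternating linear0. Qed.

Fact sub_lie_jacobi u v w :
  sub_lie u (sub_lie v w) + sub_lie v (sub_lie w u) + sub_lie w (sub_lie u v)
  = 0.
Proof.
by apply: subvs_inj; rewrite !linearD /= !vsval_sub_lie lie_jacobi.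
Qed.

HB.instance Definition _ := Vector_isLie.Build K (subvs_of H)
  sub_lie_linearr sub_lie_linearl sub_lie_alternating sub_lie_jacobi.

End SubLie.

(* K^o is the one-dimensional (hence abelian) Lie algebra over K. *)
Section LineLie.
Variable K : fieldType.

Definition line_lie (x y : K^o) : K^o := 0.

Fact line_lie_linearr x : linear (line_lie x).
Proof. by move=> a u v; rewrite /line_lie scaler0 addr0. Qed.

Fact line_lie_linearl y : linear (fun x => line_lie x y).
Proof. by move=> a u v; rewrite /line_lie scaler0 addr0. Qed.

Fact line_lie_alternating x : line_lie x x = 0.
Proof. by []. Qed.

Fact line_lie_jacobi x y z :
  line_lie x (line_lie y z) + line_lie y (line_lie z x)
  + line_lie z (line_lie x y) = 0.
Proof. by rewrite /line_lie !addr0. Qed.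

HB.instance Definition _ := Vector_isLie.Build K K^o
  line_lie_linearr line_lie_linearl line_lie_alternating line_lie_jacobi.

End LineLie.

Section PairLie.
Variables (K : fieldType) (L1 L2 : lieAlgType K).

Definition pair_lie (x y : L1 * L2) : L1 * L2 :=
  (lie x.1 y.1, lie x.2 y.2).

Fact pair_lie_linearr x : linear (pair_lie x).
Proof. by move=> a u v; rewrite /pair_lie /= !linearP. Qed.

Fact pair_lie_linearl y : linear (fun x => pair_lie x y).
Proof.
move=> a u v; rewrite /pair_lie /=.
by rewrite (@lie_linearl K L1 y.1) (@lie_linearl K L2 y.2).
Qed.

Fact pair_lie_alternating x : pair_lie x x = 0.
Proof. by rewrite /pair_lie !lie_alternating. Qed.

Fact pair_lie_jacobi x y z :
  pair_lie x (pair_lie y z) + pair_lie y (pair_lie z x)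
  + pair_lie z (pair_lie x y) = 0.
Proof. by apply: injective_projections; rewrite /= lie_jacobi. Qed.

HB.instance Definition _ := Vector_isLie.Build K (L1 * L2)%type
  pair_lie_linearr pair_lie_linearl pair_lie_alternating pair_lie_jacobi.

End PairLie.

Section RestrictedAdjoint.
Variables (K : fieldType) (L : lieAlgType K).

Definition derived_alg : {vspace L} := derived {:L}.

Lemma lie_derived_alg (x y : L) : lie x y \in derived_alg.
Proof.
have /lie_prodP := subvv derived_alg.
by apply; apply: memvf.
Qed.

Definition radj_fun (x : L) (u : subvs_of derived_alg) : subvs_of derived_alg :=
  vsproj derived_alg (lie x (vsval u)).

(* The operator a_x : the bracket lands in the derived algebra, so the
   projection vsproj does nothing (see vsval_radj). *)
Definition radj (x : L) : 'End(subvs_of derived_alg) := linfun (radj_fun x).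

Fact radj_fun_linear x : linear (radj_fun x).
Proof. by move=> a u v; rewrite /radj_fun !linearP. Qed.

HB.instance Definition _ x :=
  GRing.isLinear.Build K _ _ *:%R (radj_fun x) (radj_fun_linear x).

Lemma vsval_radj x u : vsval (radj x u) = lie x (vsval u).
Proof. by rewrite lfunE /= vsprojK // lie_derived_alg. Qed.

Fact radj_linear : linear radj.
Proof.
move=> a x y; apply/lfunP => u; apply: subvs_inj.
rewrite add_lfunE scale_lfunE linearP /= !vsval_radj.
exact: lie_linearl.
Qed.

HB.instance Definition _ := GRing.isLinear.Build K _ _ *:%R radj radj_linear.

(* The set of all a_x is a linear image, hence equal to its span. *)
Definition radj_span : {vspace 'End(subvs_of derived_alg)} := limg (linfun radj).

Lemma radj_spanP (W : {vspace 'End(subvs_of derived_alg)}) :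
  reflect (forall x, radj x \in W) (radj_span <= W)%VS.
Proof.
apply: (iffP subvP) => [H x|H _ /memv_imgP[x _ ->]].
  by apply: H; rewrite -[radj x](lfunE radj) memv_img ?memvf.
by rewrite lfunE.
Qed.

Definition good_pair (Y Z : L) : Prop :=
  [/\ free [:: Y; Z], Y \notin derived_alg /\ Z \notin derived_alg,
      radj Y = 0, radj Z <> 0 & radj_span = <[radj Z]>%VS].

Definition nonsingular (V : vectType K) (f : 'End(V)) : Prop :=
  lker f = 0%VS.

(* Columns are the coordinates of [Z, X_j]. *)
Definition ad_matrix m (X : m.-tuple L) (Z : L) : 'M[K]_m :=
  \matrix_(i, j) coord X i (lie Z X`_j).

End RestrictedAdjoint.

Arguments derived_alg {K} L.
Arguments radj_span {K} L.

Definition lie_codim2 (K : fieldType) (n : nat) (L : lieAlgType K) : Prop :=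
  [/\ \dim {:L} = n, lie_solvable {:L}, lie_commutative (derived_alg L),
      \dim (derived_alg L) = (n - 2)%N & \dim (radj_span L) = 1%N].

Section NormalForms.
Variables (K : fieldType) (m : nat).
Implicit Types (A : 'M[K]_m) (M N : 'M[K]_m.+1).

Definition form_ul A : 'M[K]_m.+1 :=
  castmx (addn1 m, addn1 m) (block_mx A 0 0 (0 : 'M_1)).

Definition form_ur A : 'M[K]_m.+1 :=
  castmx (addn1 m, add1n m) (block_mx (0 : 'M_(m, 1)) A (0 : 'M_1) 0).

Definition normal_form M : Prop :=
  exists2 A : 'M[K]_m, A \in unitmx & M = form_ul A \/ M = form_ur A.

End NormalForms.

Definition prop_similar (K : fieldType) (m : nat) (A B : 'M[K]_m) : Prop :=
  exists c : K, exists C : 'M[K]_m,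
    [/\ c != 0, C \in unitmx & c *: A = invmx C *m B *m C].

(* The Lie algebra with basis X_0, ..., X_m, Y, Z whose nonzero brackets are
   [Z, Y] = X_m and [Z, X_j] = \sum_i M i j X_i; the triple (x, (y, z)) stands
   for \sum_i x_i X_i + y Y + z Z. *)
Definition mx_lie_alg (K : fieldType) (m : nat) (M : 'M[K]_m.+1) : Type :=
  ('cV[K]_m.+1 * (K^o * K^o))%type.

Section MatrixLie.
Variables (K : fieldType) (m : nat) (M : 'M[K]_m.+1).
Local Notation T := (mx_lie_alg M).

HB.instance Definition _ := Vector.on T.

Definition mxX (j : 'I_m.+1) : T := (delta_mx j 0, (0, 0)).
Definition mxY : T := (0, (1, 0)).
Definition mxZ : T := (0, (0, 1)).

Definition mx_lie (u v : T) : T :=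
  (u.2.2 *: (M *m v.1) - v.2.2 *: (M *m u.1)
   + (u.2.2 * v.2.1 - v.2.2 * u.2.1) *: delta_mx ord_max 0, (0, 0)).

Fact mx_lie_alternating u : mx_lie u u = 0.
Proof. by rewrite /mx_lie !subrr scale0r addr0. Qed.

Fact mx_lie_linearr u : linear (mx_lie u).
Proof.
move=> a [v [vy vz]] [w [wy wz]]; case: u => x [y z].
apply: injective_projections; last by apply: injective_projections;
  rewrite /= scaler0 addr0.
apply/matrixP => i j; rewrite /mx_lie /= mulmxDr -scalemxAr !mxE.
by rewrite -![a *: _]/(a * _); ring.
Qed.

Fact mx_lie_linearl v : linear (fun u => mx_lie u v).
Proof.
move=> a [u [uy uz]] [w [wy wz]]; case: v => x [y z].
apply: injective_projections; last by apply: injective_projections;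
  rewrite /= scaler0 addr0.
apply/matrixP => i j; rewrite /mx_lie /= mulmxDr -scalemxAr !mxE.
by rewrite -![a *: _]/(a * _); ring.
Qed.

Fact mx_lie_jacobi u v w :
  mx_lie u (mx_lie v w) + mx_lie v (mx_lie w u) + mx_lie w (mx_lie u v) = 0.
Proof.
case: u v w => [u [uy uz]] [v [vy vz]] [w [wy wz]].
apply: injective_projections; last by apply: injective_projections;
  rewrite /= !addr0.
apply/matrixP => i j; rewrite /mx_lie /= !mulmxDr !mulmxN -!scalemxAr !mxE.
by ring.
Qed.

HB.instance Definition _ := Vector_isLie.Build K T
  mx_lie_linearr mx_lie_linearl mx_lie_alternating mx_lie_jacobi.

Lemma lie_mxZX j : lie mxZ (mxX j) = \sum_i M i j *: mxX i.
Proof.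
apply: injective_projections; last first.
  rewrite (big_morph snd (id1 := 0) (op1 := +%R)) // big1 // => i _.
  by apply: injective_projections; rewrite /= scaler0.
rewrite (big_morph fst (id1 := 0) (op1 := +%R)) //=.
rewrite scale1r scale0r subr0 mulr0 mul0r subr0 scale0r addr0.
apply/colP => i; rewrite summxE -colE mxE (bigD1 i) //= !mxE !eqxx mulr1.
by rewrite big1 ?addr0 // => k /negPf ki; rewrite !mxE eq_sym ki mulr0.
Qed.

Lemma lie_mxZY : lie mxZ mxY = mxX ord_max.
Proof.
apply: injective_projections => //=.
by rewrite mulmx0 !scaler0 subr0 mulr1 mul0r subr0 scale1r add0r.
Qed.

Lemma lie_mxXX i j : lie (mxX i) (mxX j) = 0.
Proof.
by apply: injective_projections => //=; rewrite !scale0r !mul0r !subrr scale0r addr0.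
Qed.

Lemma lie_mxXY i : lie (mxX i) mxY = 0.
Proof.
by apply: injective_projections => //=; rewrite !scale0r !mul0r !subrr scale0r addr0.
Qed.

End MatrixLie.

(* Main.v *)
(* The kernel of X |-> a_X has codimension one and contains the derived ideal D
   properly, so G = D + <Y> + <Z> with Y in that kernel, and
   D = im a_Z + <[Z, Y]>.  If [Z, Y] lies in im a_Z (in particular when a_Z is
   nonsingular) a translate of Y by D is central and splits off.  Otherwise
   im a_Z is a hyperplane of D not containing [Z, Y], and the centraliser of any
   x with a_x <> 0 is <x> + ker a_Z: two commuting summands containing such
   elements would be too small, and a summand without such elements is central,
   hence contained in both D and the other summand.  The two normal forms
   correspond to ker a_Z being transverse to, or contained in, im a_Z.  For the
   classification, an isomorphism f with f(Z) = c Z + ... restricts to C on the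
   derived ideal with C A = c B C; conversely C extends to Y and Z because
   im B and e_m together span. *)
Require Import Defs.
From HB Require Import structures.
From mathcomp Require Import all_boot all_order all_algebra ring.
From mathcomp Require Import reals.

Set Implicit Arguments.
Unset Strict Implicit.
Unset Printing Implicit Defensive.

Import Order.TTheory GRing.Theory Num.Theory.
Local Open Scope ring_scope.

(** * Normal forms of a singular endomorphism whose image and a line span the space *)

Section NormalForm.
Variables (K : fieldType) (m : nat) (V : vectType K) (a : 'End(V)).

Lemma cast_ord_addn1 (k : 'I_m.+1) : cast_ord (esym (addn1 m)) k =
  if unlift ord_max k is Some k' then lshift 1 k' else rshift m ord0.
Proof.
apply: val_inj => /=; case: unliftP => [k' ->|->] /=; last by rewrite addn0.
by rewrite /bump leqNgt ltn_ord.
Qed.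

(** Read through [unlift], both shapes amount to deleting the last row and one column: the last one
    here, the first one in [form_urE]. *)
Lemma form_ulE (A : 'M[K]_m) i j :
  form_ul A i j = if unlift ord_max i is Some i' then
                    if unlift ord_max j is Some j' then A i' j' else 0 else 0.
Proof.
rewrite /form_ul castmxE /block_mx !mxE.
rewrite !cast_ord_addn1; case: (unlift _ i) => [i'|]; case: (unlift _ j) => [j'|].
- by rewrite (unsplitK (inl _)) mxE (unsplitK (inl _)).
- by rewrite (unsplitK (inl _)) mxE (unsplitK (inr _)) mxE.
- by rewrite (unsplitK (inr _)) mxE (unsplitK (inl _)) mxE.
- by rewrite (unsplitK (inr _)) mxE (unsplitK (inr _)) mxE.
Qed.

Lemma form_urE (A : 'M[K]_m) i j :
  form_ur A i j = if unlift ord_max i is Some i' then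
                    if unlift ord0 j is Some j' then A i' j' else 0 else 0.
Proof.
rewrite /form_ur castmxE /block_mx !mxE.
have dE (k : 'I_m.+1) : cast_ord (esym (add1n m)) k =
    if unlift ord0 k is Some k' then rshift 1 k' else lshift m ord0.
  by apply: val_inj => /=; case: unliftP => [k' ->|->].
rewrite cast_ord_addn1 dE; case: (unlift _ i) => [i'|]; case: (unlift _ j) => [j'|].
- by rewrite (unsplitK (inl _)) mxE (unsplitK (inr _)).
- by rewrite (unsplitK (inl _)) mxE (unsplitK (inl _)) mxE.
- by rewrite (unsplitK (inr _)) mxE (unsplitK (inr _)) mxE.
- by rewrite (unsplitK (inr _)) mxE (unsplitK (inl _)) mxE.
Qed.

(** Column [p] and the last row vanish, so what remains is to invert the block [A] left over. A
    vector killed by [A] gives one killed by [a], hence a multiple of the basis vector of index [p]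
    that lies in the span of the others, hence zero. *)
Lemma normal_form_matrix (X : m.+1.-tuple V) (p : 'I_m.+1) :
  basis_of {:V} X -> \dim (lker a) = 1%N -> a X`_p = 0 ->
  (forall j : 'I_m.+1, coord X ord_max (a X`_j) = 0) ->
  p = ord0 \/ p = ord_max ->
  normal_form (\matrix_(i, j) coord X i (a X`_j)).
Proof.
move=> bX dk ap last0 pE; have fX := basis_free bX; set M := \matrix_(i, j) _.
pose A := \matrix_(i < m, j < m) M (lift ord_max i) (lift p j).
have ME i j : M i j = if unlift ord_max i is Some i' then
                 if unlift p j is Some j' then A i' j' else 0 else 0.
  case: unliftP => [i' ->|->]; last by rewrite mxE last0.
  case: unliftP => [j' ->|->]; first by rewrite [RHS]mxE.
  by rewrite mxE ap linear0.
exists A; last first.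
  by case: pE => pE; [right|left]; apply/matrixP => i j;
     rewrite ?form_ulE ?form_urE ME pE.
rewrite -unitmx_tr -row_free_unit; apply: inj_row_free => v vA.
pose y := \sum_j v 0 j *: X`_(lift p j).
have Xp0 : X`_p != 0.
  by apply: (free_not0 fX); rewrite mem_nth ?size_tuple.
have kE : lker a = <[X`_p]>%VS.
  by apply/esym/eqP; rewrite eqEdim dk dim_vline Xp0 -memvE memv_ker ap eqxx.
have : y \in lker a.
  rewrite memv_ker (coord_basis bX (memvf (a y))); apply/eqP/big1 => i _.
  suff -> : coord X i (a y) = 0 by rewrite scale0r.
  rewrite !linear_sum; case: (unliftP ord_max i) => [i'|] ->; last first.
    by apply: big1 => j _; rewrite !linearZ /= (last0 (lift p j)) mulr0.
  have := congr1 (fun w : 'rV_m => w 0 i') vA; rewrite !mxE => {2}<-.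
  by apply: eq_bigr => j _; rewrite !linearZ /= !mxE.
rewrite kE => /vlineP[c yE].
have cX (i k : 'I_m.+1) : coord X i X`_k = (k == i)%:R by rewrite coord_free.
apply/rowP => j; rewrite mxE.
have := congr1 (coord X (lift p j)) yE.
rewrite linear_sum linearZ /= cX (negPf (neq_lift _ _)) mulr0 => <-.
rewrite (bigD1 j) //= linearZ /= (cX _ (lift p j)) eqxx mulr1 big1 ?addr0 // => k kj.
by rewrite linearZ /= (cX _ (lift p k)) (inj_eq lift_inj) (negPf kj) mulr0.
Qed.

Variable w : V.
Hypothesis dimV : \dim {:V} = m.+1.
Hypothesis limg_line : (limg a + <[w]> = fullv)%VS.
Hypothesis singular_a : lker a <> 0%VS.

(** The line adds at most one dimension, so the image has dimension at least [m]; the non-zero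
    kernel keeps it below [m.+1]. *)
Lemma singular_dim_limg : \dim (limg a) = m.
Proof.
apply/eqP; rewrite eqn_leq; apply/andP; split.
  have := limg_ker_dim a fullv; rewrite capfv dimV => E.
  have : (0 < \dim (lker a))%N by rewrite lt0n dimv_eq0; apply/eqP.
  by case: (\dim _) E => // k [<-] _; rewrite leq_addl.
have := dimv_add_leqif (limg a) <[w]>%VS; rewrite limg_line dimV dim_vline => -[le _].
by rewrite -(leq_add2r 1) addn1 (leq_trans le) // leq_add2l leq_b1.
Qed.

Lemma singular_dim_lker : \dim (lker a) = 1%N.
Proof.
have := limg_ker_dim a fullv; rewrite capfv dimV singular_dim_limg -add1n.
by move/eqP; rewrite eqn_add2r => /eqP.
Qed.

Lemma singular_line_notin : w \notin limg a.
Proof.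
apply/negP => wI; have := singular_dim_limg.
have -> : limg a = fullv by rewrite -[RHS]limg_line; apply/esym/addv_idPl; rewrite -memvE.
by rewrite dimV => /esym/n_Sn.
Qed.

(** The basis [X] is [B] followed by [b]. As [size B = m], the default value of [nth b B p] is
    reached exactly for [p = ord_max], so [p] is the position of the kernel vector in [X]. *)
Lemma singular_normal_form_aux (B : seq V) (b : V) (p : 'I_m.+1) :
    basis_of (limg a) B -> size B = m -> w - b \in limg a ->
    nth b B p \in lker a -> p = ord0 \/ p = ord_max ->
  exists X : m.+1.-tuple V, [/\ basis_of {:V} X, tnth X ord_max = b
    & normal_form (\matrix_(i, j) coord X i (a X`_j))].
Proof.
move=> bB sB wb bp pE.
have sX : size (rcons B b) == m.+1 by rewrite size_rcons sB.
pose X := Tuple sX.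
have bX : basis_of {:V} X.
  rewrite basisEdim dimV size_tuple leqnn andbT /= -cats1 span_cat span_seq1.
  rewrite (span_basis bB) -[X in (X <= _)%VS]limg_line subv_add addvSl -memvE /=.
  by rewrite -(subrK b w) memv_add ?memv_line.
have Xi (i : 'I_m.+1) : X`_i = nth b B i.
  rewrite (set_nth_default b) ?size_tuple //= nth_rcons sB.
  by case: ltnP => // le; rewrite nth_default ?sB // if_same.
exists X; split=> //.
  by rewrite (tnth_nth 0) /= nth_rcons sB /= ltnn eqxx.
apply: (@normal_form_matrix _ p) => //; first exact: singular_dim_lker.
  by apply/eqP; rewrite -memv_ker Xi.
move=> j; have : a X`_j \in <<B>>%VS by rewrite (span_basis bB) memv_img ?memvf.
have tB : size B == m by rewrite sB.
move/(@coord_span _ _ _ (Tuple tB)) ->; rewrite linear_sum; apply: big1 => i _.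
have -> : (Tuple tB)`_i = X`_(lift ord_max i).
  by rewrite Xi lift_max (set_nth_default b) //= sB.
rewrite linearZ /= (coord_free (lift ord_max i) ord_max (basis_free bX)).
by rewrite eq_sym (negPf (neq_lift _ _)) mulr0.
Qed.

Lemma singular_normal_form : exists (u : V) (X : m.+1.-tuple V),
  [/\ basis_of {:V} X, w - a u = tnth X ord_max
    & normal_form (\matrix_(i, j) coord X i (a X`_j))].
Proof.
(* If the kernel lies in the image, it is put first in a basis of the image and [w] is kept as last
   vector; this leads to [form_ur]. *)
have [kI|kI] := boolP (lker a <= limg a)%VS.
  pose x := vpick (lker a).
  have x0 : x != 0 by rewrite vpick0; apply/eqP.
  have kE : lker a = <[x]>%VS.
    apply/esym/eqP; rewrite eqEdim -memvE memv_pick singular_dim_lker.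
    by rewrite dim_vline x0.
  pose B := x :: vbasis (limg a :\: <[x]>).
  have capE : (limg a :&: <[x]>)%VS = <[x]>%VS by apply/capv_idPr; rewrite -kE.
  have sB : size B = m.
    have := dimv_cap_compl (limg a) <[x]>.
    by rewrite capE dim_vline x0 singular_dim_limg /= size_tuple.
  have bB : basis_of (limg a) B.
    rewrite basisEdim sB singular_dim_limg leqnn andbT span_cons.
    rewrite (span_basis (vbasisP _)) addvC -[X in (_ + X)%VS]capE.
    by rewrite addv_diff_cap.
  have w0 : w - w \in limg a by rewrite subrr mem0v.
  have Bk : nth w B (@ord0 m) \in lker a by rewrite /= memv_pick.
  have [X [bX Xw nf]] := singular_normal_form_aux bB sB w0 Bk (or_introl erefl).
  by exists 0, X; rewrite linear0 subr0 Xw.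
(* Otherwise image and kernel are complementary, and the kernel component [k = w - a u] of [w]
   becomes the last vector; this leads to [form_ul]. *)
have full : (limg a + lker a)%VS = fullv.
  apply/eqP; rewrite eqEdim subvf dimV -[X in (X < _)%N]singular_dim_limg.
  rewrite (ltn_leqif (dimv_leqif_eq (addvSl _ (lker a)))).
  by apply: contra kI => /eqP->; rewrite addvSr.
have : w \in (limg a + lker a)%VS by rewrite full memvf.
case/memv_addP => _ /memv_imgP[u _ ->] [k kk wE].
have wau : w - a u = k by rewrite wE addrC addKr.
have sB : size (vbasis (limg a)) = m by rewrite size_tuple singular_dim_limg.
have wk : w - k \in limg a by rewrite wE addrK memv_img ?memvf.
have Bk : nth k (vbasis (limg a)) (@ord_max m) \in lker a by rewrite nth_default ?sB.
have [X [bX Xk nf]] :=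
  singular_normal_form_aux (vbasisP _) sB wk Bk (or_intror erefl).
by exists u, X; rewrite wau Xk.
Qed.

End NormalForm.

(** * Bijective linear maps and Lie isomorphisms *)

Section LinearIso.
Variables (K : fieldType) (U V : vectType K).

Lemma linear_bij (f : {linear U -> V}) :
  (forall u, f u = 0 -> u = 0) -> (forall v, exists u, f u = v) -> bijective f.
Proof.
move=> injf surjf; pose F := linfun f.
have kerF : lker F == 0%VS.
  by rewrite -subv0; apply/subvP => u; rewrite memv_ker memv0 lfunE /= => /eqP/injf->.
exists (fun v => F^-1%VF v) => [u|v]; rewrite -[f _](lfunE f) -/F.
  by rewrite lker0_lfunK.
apply: limg_lfunVK; have [u <-] := surjf v.
by rewrite -[f u](lfunE f) memv_img ?memvf.
Qed.

Variable W : {vspace V}.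

Lemma vsvalD (u v : subvs_of W) : vsval (u + v) = vsval u + vsval v.
Proof. exact: linearD. Qed.

Lemma vsvalB (u v : subvs_of W) : vsval (u - v) = vsval u - vsval v.
Proof. exact: linearB. Qed.

Lemma vsvalZ a (u : subvs_of W) : vsval (a *: u) = a *: vsval u.
Proof. exact: linearZ. Qed.

Lemma vsval0 : vsval (0 : subvs_of W) = 0.
Proof. exact: linear0. Qed.

End LinearIso.

Section LieIso.
Variable K : fieldType.

Lemma lie_isomorphism_inv (L1 L2 : lieAlgType K) (f : {linear L1 -> L2}) :
  lie_isomorphism f ->
  exists g : {linear L2 -> L1}, [/\ lie_isomorphism g, cancel f g & cancel g f].
Proof.
case=> -[g fg gf] fM; have gL := can2_linear fg gf.
pose g' := GRing.isLinear.Build K L2 L1 *:%R g gL.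
pose h : {linear L2 -> L1} := HB.pack g g'.
exists h; split=> //; split; first by exists f.
by move=> x y; apply: (can_inj fg); rewrite fM !gf.
Qed.

Lemma lie_isomorphic_sym (L1 L2 : lieAlgType K) :
  lie_isomorphic L1 L2 -> lie_isomorphic L2 L1.
Proof. by case=> f /lie_isomorphism_inv[g [gI _ _]]; exists g. Qed.

End LieIso.

(** * Bilinearity of the bracket and linearity of the restricted adjoint *)

Section LieBasics.
Variables (K : fieldType) (L : lieAlgType K).
Implicit Types x y z : L.

Lemma lieDl x y z : lie (x + y) z = lie x z + lie y z.
Proof. by have := @lie_linearl K L z 1 x y; rewrite !scale1r. Qed.

Lemma lieDr x y z : lie x (y + z) = lie x y + lie x z.
Proof. exact: raddfD. Qed.

Lemma lieZr a x y : lie x (a *: y) = a *: lie x y.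
Proof. exact: linearZ. Qed.

Lemma lieZl a x y : lie (a *: x) y = a *: lie x y.
Proof. by rewrite lieNC lieZr -scalerN -lieNC. Qed.

Lemma radjD x y : radj (x + y) = radj x + radj y.
Proof. by have := @radj_linear K L 1 x y; rewrite !scale1r. Qed.

Lemma radj0 : radj (0 : L) = 0.
Proof. by apply: (addrI (radj 0)); rewrite -radjD !addr0. Qed.

Lemma radjZ a x : radj (a *: x) = a *: radj x.
Proof. by have := @radj_linear K L a x 0; rewrite radj0 !addr0. Qed.

Lemma radjB x y : radj (x - y) = radj x - radj y.
Proof. by rewrite radjD -scaleN1r radjZ scaleN1r. Qed.

End LieBasics.

(** * The kernel of [radj] and the existence of [Y] and [Z] *)

Section Codim2.
Variables (K : fieldType) (m : nat) (G : lieAlgType K).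
Hypothesis hG : lie_codim2 m.+3 G.
Local Notation D := (derived_alg G).

Let dimG : \dim {:G} = m.+3. Proof. by case: hG. Qed.
Let dimD : \dim D = m.+1. Proof. by case: hG => _ _ _ -> _; rewrite !subSS subn0. Qed.
Let commD : {in D &, forall u v, lie u v = 0}. Proof. by case: hG. Qed.
Let dim_span : \dim (radj_span G) = 1%N. Proof. by case: hG. Qed.

Let radjF := linfun (@radj K G).

Lemma dim_ker_radj : \dim (lker radjF) = m.+2.
Proof.
have := limg_ker_dim radjF fullv; rewrite capfv dimG -/(radj_span G) dim_span.
by rewrite addn1 => -[].
Qed.

Lemma radj_derived u : u \in D -> radj u = 0.
Proof.
move=> uD; apply/lfunP => v; apply: subvs_inj.
by rewrite vsval_radj zero_lfunE linear0 commD ?subvsP.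
Qed.

Lemma radj_eq0P Y : radj Y = 0 <-> {in D, forall u, lie Y u = 0}.
Proof.
split=> [Y0 u uD|Y0].
  by rewrite -(vsprojK uD) -vsval_radj Y0 zero_lfunE linear0.
by apply/lfunP => v; apply: subvs_inj; rewrite vsval_radj zero_lfunE linear0 Y0 ?subvsP.
Qed.

Lemma derived_sub_ker : (D <= lker radjF)%VS.
Proof. by apply/subvP => u uD; rewrite memv_ker lfunE /= radj_derived. Qed.

(** Applying [radj] to a relation between [Y] and [Z] isolates the coefficient of [Z]; the span of
    all [radj x] is a line, so the non-zero [radj Z] generates it. *)
Lemma good_pairP Y Z :
  Y \notin D -> radj Y = 0 -> radj Z <> 0 -> good_pair Y Z.
Proof.
move=> YD Y0 Z0.
have ZD : Z \notin D by apply/negP => /radj_derived.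
split=> //.
  rewrite free_cons seq1_free span_seq1; apply/andP; split; last first.
    by apply/eqP => ZE; case: Z0; rewrite ZE radj0.
  apply/negP => /vlineP[c YE]; have := Y0; rewrite YE radjZ => /eqP.
  rewrite scaler_eq0 => /orP[/eqP c0|/eqP//].
  by move: YD; rewrite YE c0 scale0r mem0v.
apply/eqP; rewrite eq_sym eqEdim dim_span -memvE dim_vline.
rewrite -[radj Z](lfunE (@radj K G)) memv_img ?memvf //.
by rewrite lfunE /=; move/eqP: Z0 => ->.
Qed.

(** The dimension [m.+2] of the kernel of [radj] lies strictly between those of [D] and [G], which
    leaves room for [Y] inside the kernel and [Z] outside. *)
Lemma good_pair_exists : exists Y Z : G, good_pair Y Z.
Proof.
have /subvPn[Y Yk YD] : ~~ (lker radjF <= D)%VS.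
  by apply/negP => /dimvS; rewrite dim_ker_radj dimD ltnn.
have /subvPn[Z _ Zk] : ~~ (fullv <= lker radjF)%VS.
  by apply/negP => /dimvS; rewrite dim_ker_radj dimG ltnn.
exists Y, Z; apply: good_pairP => //.
  by apply/eqP; rewrite -[radj Y](lfunE (@radj K G)) -memv_ker.
by apply/eqP; rewrite -[radj Z](lfunE (@radj K G)) -memv_ker.
Qed.

(** * Coordinates along the derived ideal, [Y] and [Z] *)

Section GoodPair.
Variables (Y Z : G).
Hypothesis gp : good_pair Y Z.

Let YD : Y \notin D. Proof. by case: gp => _ []. Qed.
Let Y0 : radj Y = 0. Proof. by case: gp. Qed.
Let Z0 : radj Z <> 0. Proof. by case: gp. Qed.

Lemma lie_Y_derived : {in D, forall u, lie Y u = 0}.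
Proof. exact/radj_eq0P. Qed.

Lemma decompose x :
  exists u : subvs_of D, exists y z, x = vsval u + y *: Y + z *: Z.
Proof.
have xZ : radj x \in <[radj Z]>%VS.
  by case: gp => _ _ _ _ <-; rewrite -[radj x](lfunE (@radj K G)) memv_img ?memvf.
(* [D] is a hyperplane of the kernel that misses [Y]. *)
have kerE : lker radjF = (D + <[Y]>)%VS.
  apply/eqP; rewrite eq_sym eqEdim subv_add derived_sub_ker -memvE memv_ker.
  rewrite lfunE /= Y0 eqxx dim_ker_radj -[X in (X < _)%N]dimD.
  rewrite (ltn_leqif (dimv_leqif_eq (addvSl D <[Y]>))).
  apply: contra YD => /eqP ->; exact: (subvP (addvSr _ _)) (memv_line _).
have /vlineP[z xE] := xZ.
have : x - z *: Z \in lker radjF.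
  by rewrite memv_ker lfunE /= radjB radjZ xE subrr.
rewrite kerE => /memv_addP[u uD [_ /vlineP[y ->] xE']].
by exists (vsproj D u), y, z; rewrite vsprojK // -xE' subrK.
Qed.

Lemma decompose0 (u : subvs_of D) y z :
  vsval u + y *: Y + z *: Z = 0 -> [/\ u = 0, y = 0 & z = 0].
Proof.
move=> E; have uD := subvsP u.
have z0 : z = 0.
  have := congr1 (@radj K G) E; rewrite !radjD !radjZ Y0 radj_derived //.
  rewrite scaler0 !add0r radj0 => /eqP.
  by rewrite scaler_eq0 => /orP[/eqP//|/eqP].
move: E; rewrite z0 scale0r addr0 => E.
have y0 : y = 0.
  apply: contraNeq YD => yn0; rewrite -[Y](scalerK yn0).
  by move/eqP: E; rewrite addrC addr_eq0 => /eqP->; rewrite rpredZ ?rpredN.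
by move: E; rewrite y0 scale0r addr0 => E; split=> //; apply: subvs_inj; rewrite linear0.
Qed.

(** Only brackets with [Z] survive, since [D] is abelian and [Y] commutes with it; hence [radj Z]
    and [lie Z Y] carry the whole structure. *)
Lemma lie_coords (u u' : subvs_of D) y y' z z' :
  lie (vsval u + y *: Y + z *: Z) (vsval u' + y' *: Y + z' *: Z) =
  z *: lie Z (vsval u') - z' *: lie Z (vsval u) + (z * y' - z' * y) *: lie Z Y.
Proof.
have uD := subvsP u; have uD' := subvsP u'.
rewrite !(lieDl, lieDr, lieZl, lieZr) !lie_alternating commD //.
rewrite lie_Y_derived // [lie _ Y]lieNC lie_Y_derived //.
rewrite [lie Y Z]lieNC [lie (vsval u) Z]lieNC.
rewrite !(scaler0, oppr0, addr0, add0r) scalerBl !scalerN !scalerA [z' * y]mulrC.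
by rewrite scalerDr scalerA addrC addrACA.
Qed.

Lemma good_pair_translate u : u \in D -> good_pair (Y - u) Z.
Proof.
move=> uD; apply: good_pairP => //; last by rewrite radjB Y0 radj_derived // subr0.
by apply: contra YD => YuD; rewrite -(subrK u Y) rpredD.
Qed.

(** Brackets span [D], and by [lie_coords] each of them is a value of [radj Z] plus a multiple of
    [lie Z Y]. *)
Lemma limg_radj_line :
  (limg (radj Z) + <[vsproj D (lie Z Y)]> = fullv)%VS.
Proof.
apply/eqP; rewrite eqEsubv subvf; apply/subvP => v _.
set I := (_ + _)%VS.
suff : (D <= linfun vsval @: I)%VS.
  move/subvP/(_ _ (subvsP v))/memv_imgP => [v' v'I].
  by rewrite lfunE /= => /subvs_inj->.
apply/lie_prodP => x x' _ _.
have [u [y [z ->]]] := decompose x; have [u' [y' [z' ->]]] := decompose x'.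
rewrite lie_coords; apply/memv_imgP.
exists (z *: radj Z u' - z' *: radj Z u + (z * y' - z' * y) *: vsproj D (lie Z Y)).
  by rewrite memv_add ?rpredB ?rpredZ ?memv_img ?memvf ?memv_line.
by rewrite lfunE /= !vsval_radj vsprojK ?lie_derived_alg.
Qed.

(** * Splitting off a central line *)

Section Split.
Hypothesis ZY0 : lie Z Y = 0.

Lemma split_lie_Y x : lie Y x = 0.
Proof.
have [u [y [z ->]]] := decompose x.
rewrite !lieDr !lieZr lie_alternating lie_Y_derived ?subvsP // [lie Y Z]lieNC ZY0.
by rewrite oppr0 !scaler0 !addr0.
Qed.

Lemma split_line_sub : (lie_prod <[Y]> <[Y]> <= <[Y]>)%VS.
Proof.
apply/lie_prodP => _ x /vlineP[a ->] _.
by rewrite lieZl split_lie_Y scaler0 mem0v.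
Qed.

Lemma split_compl_sub : (lie_prod (D + <[Z]>) (D + <[Z]>) <= D + <[Z]>)%VS.
Proof.
apply/lie_prodP => x y _ _; apply: (subvP (addvSl _ _)); exact: lie_derived_alg.
Qed.

Let line : subalgebra G := Subalgebra split_line_sub.
Let Gb : subalgebra G := Subalgebra split_compl_sub.

Lemma split_direct_sum : lie_direct_sum line Gb.
Proof.
split=> [||u v].
- apply/eqP; rewrite eqEsubv subvf; apply/subvP => x _.
  have [u [y [z ->]]] := decompose x.
  rewrite addrAC addrC memv_add ?rpredZ ?memv_line //.
  by rewrite memv_add ?subvsP ?rpredZ ?memv_line.
- apply/eqP; rewrite -subv0; apply/subvP => x.
  rewrite memv_cap => /andP[/vlineP[y ->] /memv_addP[u uD [_ /vlineP[z ->]]]].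
  move=> E; have [_ y0 _] : [/\ vsproj D u = 0, - y = 0 & z = 0].
    apply: decompose0; rewrite vsprojK // addrAC -E scaleNr subrr //.
  by rewrite -[y]opprK y0 oppr0 scale0r mem0v.
- by move=> /vlineP[a ->] _; rewrite lieZl split_lie_Y scaler0.
Qed.

Lemma Y_neq0 : Y != 0.
Proof. by apply: contraNneq YD => ->; rewrite mem0v. Qed.

Lemma split_dim : \dim Gb = m.+2.
Proof.
have [sumE capE _] := split_direct_sum.
have := dimv_disjoint_sum capE; rewrite sumE dimG dim_vline Y_neq0.
by case.
Qed.

(** As [Y] is central, removing the [Y]-components of two elements does not change their bracket, so
    [Gb] already produces all brackets of [G]. *)
Lemma split_derived : derived Gb = D.
Proof.
apply/eqP; rewrite eqEsubv; apply/andP; split.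
  by apply/lie_prodP => x y _ _; apply: lie_derived_alg.
apply/lie_prodP => x x' _ _.
have memGb (u : subvs_of D) z : vsval u + z *: Z \in (Gb : {vspace G}).
  by rewrite memv_add ?subvsP ?rpredZ ?memv_line.
have [u [y [z ->]]] := decompose x; have [u' [y' [z' ->]]] := decompose x'.
rewrite addrAC [vsval u' + _ + _]addrAC lieDl lieZl split_lie_Y scaler0 addr0.
rewrite lieDr lieZr [lie _ Y]lieNC split_lie_Y oppr0 scaler0 addr0.
have /lie_prodP := subvv (derived Gb); apply; exact: memGb.
Qed.

Lemma split_solvable : lie_solvable Gb.
Proof.
exists 2; rewrite /= split_derived; apply/eqP; rewrite -subv0.
by apply/lie_prodP => u v uD vD; rewrite commD ?mem0v.
Qed.

(** The isomorphism is built backwards, as the sum map from the product to [G], and then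
    inverted. *)
Lemma split_isomorphic : lie_isomorphic G (K^o * subvs_of Gb)%type.
Proof.
apply: lie_isomorphic_sym.
have [sumE capE commH] := split_direct_sum.
pose f (x : K^o * subvs_of Gb) : G := (x.1 : K) *: Y + vsval x.2.
have fL : linear f.
  move=> a [s u] [t v]; rewrite /f scalerDr scalerA addrACA -vsvalZ -vsvalD.
  by rewrite -scalerDl.
pose fB := GRing.isLinear.Build K _ G *:%R f fL.
pose F : {linear (K^o * subvs_of Gb)%type -> G} := HB.pack f fB.
exists F; split.
  apply: linear_bij => [[t v] E|x]; last first.
    have : x \in (line + Gb)%VS by rewrite sumE memvf.
    case/memv_addP => _ /vlineP[t ->] [v vGb ->].
    by exists (t, vsproj Gb v); rewrite /= /f /= vsprojK.
  have vE : vsval v = (- t : K) *: Y.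
    by move/eqP: E; rewrite /= /f /= addrC addr_eq0 scaleNr => /eqP.
  have v0 : vsval v = 0.
    apply/eqP; rewrite -memv0 -capE memv_cap subvsP andbT vE.
    by rewrite rpredZ ?memv_line.
  have t0 : t = 0.
    move/esym/eqP: vE; rewrite v0 scaler_eq0 oppr_eq0 (negPf Y_neq0) orbF.
    by move/eqP.
  by congr (_, _) => //; apply: subvs_inj; rewrite v0 linear0.
move=> [s u] [t v].
(* A bracket in the product has first component zero, the line being abelian. *)
rewrite -[LHS]/((0 : K) *: Y + vsval (sub_lie u v)) vsval_sub_lie.
rewrite -[RHS]/(lie ((s : K) *: Y + vsval u) ((t : K) *: Y + vsval v)).
rewrite scale0r add0r lieDl lieZl split_lie_Y scaler0 add0r.
by rewrite lieDr lieZr [lie _ Y]lieNC split_lie_Y oppr0 scaler0 add0r.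
Qed.

Lemma split_case :
  decomposable G /\
  exists Gb : subalgebra G,
    [/\ \dim Gb = m.+2, lie_solvable Gb, \dim (derived Gb) = m.+1,
        derived Gb = D & lie_isomorphic G (K^o * subvs_of Gb)%type].
Proof.
split.
  exists line, Gb; split; last exact: split_direct_sum.
    by move/eqP; rewrite -dimv_eq0 dim_vline Y_neq0.
  by move/eqP; rewrite -dimv_eq0 split_dim.
exists Gb; split; rewrite ?split_derived //.
- exact: split_dim.
- exact: split_solvable.
- exact: split_isomorphic.
Qed.

End Split.

Lemma dim_subvs_derived : \dim {:subvs_of D} = m.+1.
Proof. by rewrite dimvf. Qed.

(** An injective [radj Z] is onto, so [lie Z Y] equals some [lie Z u], and [Z] commutes with
    [Y - u]. *)
Lemma nonsingular_split :
  nonsingular (radj Z) -> exists2 u, u \in D & lie Z (Y - u) = 0.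
Proof.
move=> ker0; have : vsproj D (lie Z Y) \in limg (radj Z).
  suff -> : limg (radj Z) = fullv by rewrite memvf.
  apply/eqP; rewrite eqEdim subvf /=.
  by rewrite -[X in (X <= _)%N](limg_ker_dim (radj Z)) ker0 capv0 dimv0 leqnn.
case/memv_imgP=> u _ uE; exists (vsval u); first exact: subvsP.
by rewrite raddfB /= -(vsprojK (lie_derived_alg Z Y)) uE vsval_radj subrr.
Qed.

(** * Singular [radj Z]: indecomposability and the normal basis *)

Section Singular.
Hypothesis sing : lker (radj Z) <> 0%VS.

Let w := vsproj D (lie Z Y).
Let wE : vsval w = lie Z Y. Proof. by rewrite vsprojK // lie_derived_alg. Qed.

(** [lie Z Y] lies outside the image of [radj Z], so both terms of the relation vanish
    separately. *)
Lemma singular_coord_eq0 (u : subvs_of D) c :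
  lie Z (vsval u) + c *: lie Z Y = 0 -> c = 0 /\ u \in lker (radj Z).
Proof.
rewrite -vsval_radj -wE -vsvalZ -vsvalD -[0](vsval0 D) => /subvs_inj E.
have c0 : c = 0.
  apply: contraNeq (singular_line_notin dim_subvs_derived limg_radj_line sing) => cn0.
  rewrite -/w -[w](scalerK cn0) rpredZ // -rpredN.
  by move/eqP: E; rewrite addr_eq0 => /eqP <-; rewrite memv_img ?memvf.
by move: E; rewrite c0 scale0r addr0 memv_ker => ->.
Qed.

(** Write [x = u + y Y + z Z] with [z] non-zero and [h = v + b Y + a Z]. The vanishing bracket
    forces [z b = a y] and puts [z v - a u] in the kernel of [radj Z], whence
    [h = (a / z) x + (z v - a u) / z]. *)
Lemma centralizer x h : radj x <> 0 -> lie x h = 0 ->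
  exists c, exists2 k, k \in lker (radj Z) & h = c *: x + vsval k.
Proof.
have [u [y [z ->]]] := decompose x; have [v [b [a ->]]] := decompose h.
rewrite !radjD !radjZ Y0 radj_derived ?subvsP // scaler0 !add0r => /eqP.
rewrite scaler_eq0 negb_or => /andP[zn0 _].
rewrite lie_coords => E.
have := @singular_coord_eq0 (z *: v - a *: u) (z * b - a * y).
rewrite vsvalB !vsvalZ raddfB /= !lieZr => /(_ E)[/eqP].
rewrite subr_eq0 => /eqP zb kk.
exists (a / z), (z^-1 *: (z *: v - a *: u)); first by rewrite rpredZ.
rewrite vsvalZ vsvalB !vsvalZ !scalerDr scalerN !scalerA mulVf // scale1r.
have -> : a / z * y = b by rewrite mulrAC -zb mulrC mulKf.
by rewrite divfK // [z^-1 * a]mulrC [RHS]addrC -!addrA addKr.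
Qed.

Lemma lie_direct_sumC (H1 H2 : subalgebra G) :
  lie_direct_sum H1 H2 -> lie_direct_sum H2 H1.
Proof.
case=> sumE capE commH; split; rewrite 1?addvC 1?capvC // => u v uH vH.
by rewrite lieNC commH ?oppr0.
Qed.

(** Some [x] in [H1] with [radj x] non-zero commutes with [H2], so each element of [H2] is [c x + k]
    with [k] killed by [radj Z]; applying [radj] gives [c = 0]. Thus [H2] is central and contained
    in [D], all brackets come from [H1], and [D] lies in [H1]. *)
Lemma summand_ker0 (H1 H2 : subalgebra G) :
  lie_direct_sum H1 H2 -> ~~ (H1 <= lker radjF)%VS -> (H2 <= lker radjF)%VS ->
  (H2 : {vspace G}) = 0%VS.
Proof.
case=> sumE capE commH /subvPn[x xH xk] /subvP H2k.
have x0 : radj x <> 0.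
  by move=> x0; move: xk; rewrite memv_ker lfunE /= x0 eqxx.
have H2_ker h : h \in (H2 : {vspace G}) -> exists2 k, k \in lker (radj Z) & h = vsval k.
  move=> hH; have [c [k kk hE]] := centralizer x0 (commH _ _ xH hH).
  exists k => //; suff c0 : c = 0 by rewrite hE c0 scale0r add0r.
  have := H2k _ hH; rewrite memv_ker lfunE /= hE radjD radjZ.
  rewrite (radj_derived (subvsP k)) addr0 scaler_eq0.
  by move=> /orP[/eqP//|/eqP].
have H2_central h g : h \in (H2 : {vspace G}) -> lie h g = 0.
  move=> /H2_ker[k kk ->]; have [u [y [z ->]]] := decompose g.
  rewrite !lieDr !lieZr commD ?subvsP // [lie _ Y]lieNC lie_Y_derived ?subvsP //.
  rewrite [lie _ Z]lieNC -vsval_radj.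
  by move: kk; rewrite memv_ker => /eqP ->; rewrite vsval0 oppr0 !scaler0 !addr0.
have DH : (D <= H1)%VS.
  apply/lie_prodP => g g' _ _.
  have /memv_addP[g1 g1H [g2 g2H ->]] : g \in (H1 + H2)%VS by rewrite sumE memvf.
  have /memv_addP[g1' g1H' [g2' g2H' ->]] : g' \in (H1 + H2)%VS.
    by rewrite sumE memvf.
  rewrite lieDl (H2_central g2) // addr0 lieDr [lie _ g2']lieNC (H2_central g2') //.
  by rewrite oppr0 addr0 lie_subalgebra.
apply/eqP; rewrite -subv0; apply/subvP => h hH.
rewrite -capE memv_cap hH andbT; apply: (subvP DH).
by have [k _ ->] := H2_ker _ hH; apply: subvsP.
Qed.

Lemma singular_indecomposable : (0 < m)%N -> ~ decomposable G.
Proof.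
move=> m_gt0 [H1 [H2 [H10 H20 dsum]]].
have [sumE capE commH] := dsum.
have [H1k|H1k] := boolP (H1 <= lker radjF)%VS; last first.
  have [H2k|H2k] := boolP (H2 <= lker radjF)%VS.
    exact: H20 (summand_ker0 dsum H1k H2k).
  have radj_neq0 x : x \notin lker radjF -> radj x <> 0.
    by move=> + x0; rewrite memv_ker lfunE /= x0 eqxx.
  (* Each summand centralizes an element [x] or [h] of the other, so [G] lies in the sum of the
     lines of [x] and [h] and of the kernel of [radj Z]. This has dimension at most 3, less than
     [m.+3]. *)
  have /subvPn[x xH /radj_neq0 x0] := H1k.
  have /subvPn[h hH /radj_neq0 h0] := H2k.
  pose k := (linfun vsval @: lker (radj Z))%VS : {vspace G}.
  have dimk : (\dim k <= 1)%N.
    rewrite -(singular_dim_lker dim_subvs_derived limg_radj_line sing).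
    by rewrite -(limg_ker_dim (linfun vsval) (lker (radj Z))) leq_addl.
  have kmem v : v \in lker (radj Z) -> vsval v \in k.
    by move=> vk; rewrite -[vsval v](lfunE vsval) memv_img.
  have sub : (fullv <= <[x]> + (<[h]> + k))%VS.
    rewrite -sumE subv_add; apply/andP; split; apply/subvP => g gH.
      have [|c [v vk ->]] := centralizer (h := g) h0.
        by rewrite lieNC commH // oppr0.
      by rewrite (subvP (addvSr _ _)) // memv_add ?kmem ?rpredZ ?memv_line.
    have [c [v vk ->]] := centralizer x0 (commH _ _ xH gH).
    rewrite memv_add ?rpredZ ?memv_line //.
    by rewrite (subvP (addvSr _ _)) ?kmem.
  have := dimvS sub; rewrite dimG leqNgt; case/negP.
  apply: (@leq_trans 4); last by rewrite !ltnS.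
  have [le1 _] := dimv_add_leqif <[x]>%VS (<[h]> + k)%VS.
  have [le2 _] := dimv_add_leqif <[h]>%VS k.
  rewrite ltnS (leq_trans le1) // (@leq_add _ _ 1 2) ?dim_vline ?leq_b1 //.
  by rewrite (leq_trans le2) // (@leq_add _ _ 1 1) ?dim_vline ?leq_b1.
(* The kernel of [radj] is a proper subspace, so it cannot contain both summands. *)
have H2k : ~~ (H2 <= lker radjF)%VS.
  apply/negP => H2k; have := dimvS (_ : {:G} <= lker radjF)%VS.
  by rewrite -sumE subv_add H1k H2k sumE dimG dim_ker_radj ltnn => /(_ isT).
exact: H10 (summand_ker0 (lie_direct_sumC dsum) H2k H1k).
Qed.

(** The normal form of [radj Z] relative to [w] has [w - radj Z u] as last basis vector; this is the
    bracket of [Z] with [Y - u], hence the choice of [Y']. The basis is carried from [subvs_of D] to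
    [G] by [vsval]. *)
Lemma singular_normal_basis : exists (Y' : G) (X : m.+1.-tuple G),
  [/\ Y' - Y \in D, good_pair Y' Z, basis_of D X, lie Z Y' = tnth X ord_max
    & normal_form (ad_matrix X Z)].
Proof.
have [u [X [bX Xw nf]]] :=
  singular_normal_form dim_subvs_derived limg_radj_line sing.
have fX := basis_free bX.
pose X' := [tuple of map vsval X].
have X'i (i : 'I_m.+1) : X'`_i = vsval X`_i.
  by rewrite (nth_map 0) ?size_tuple.
have coordX' v : vsval v = \sum_i coord X i v *: X'`_i.
  rewrite {1}(coord_basis bX (memvf v)) linear_sum.
  by apply: eq_bigr => i _; rewrite X'i -vsvalZ.
have bX' : basis_of D X'.
  rewrite basisEdim dimD size_tuple leqnn andbT; apply/subvP => v vD.
  rewrite -(vsprojK vD) coordX'; apply: rpred_sum => i _.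
  by rewrite rpredZ // memv_span // mem_nth ?size_tuple.
have coordE v i : coord X' i (vsval v) = coord X i v.
  by rewrite coordX' coord_sum_free ?(basis_free bX').
exists (Y - vsval u), X'; split=> //.
- by rewrite addrAC subrr add0r rpredN subvsP.
- by apply: good_pair_translate; apply: subvsP.
- rewrite raddfB /= -wE -vsval_radj -vsvalB Xw.
  by rewrite !(tnth_nth 0) X'i.
suff -> : ad_matrix X' Z = \matrix_(i, j) coord X i (radj Z X`_j) by [].
by apply/matrixP => i j; rewrite !mxE X'i -vsval_radj coordE.
Qed.

End Singular.
End GoodPair.
End Codim2.

(** * Reconstruction of the algebra from [radj Z] and [lie Z Y] *)

Section Determined.
Variable K : fieldType.

Section Recon.
Variables (G : lieAlgType K) (Y Z : G).

Definition recon (x : subvs_of (derived_alg G) * (K^o * K^o)) : G :=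
  vsval x.1 + (x.2.1 : K) *: Y + (x.2.2 : K) *: Z.

Fact recon_linear : linear recon.
Proof.
move=> a [u [y z]] [u' [y' z']].
rewrite -[LHS]/(vsval (a *: u + u') + (a * y + y' : K) *: Y + (a * z + z' : K) *: Z).
rewrite -[RHS]/(a *: (vsval u + (y : K) *: Y + (z : K) *: Z) +
                (vsval u' + (y' : K) *: Y + (z' : K) *: Z)).
rewrite vsvalD vsvalZ !scalerDl !scalerDr !scalerA.
by rewrite [X in X + _ = _]addrACA [LHS]addrACA.
Qed.

HB.instance Definition _ :=
  GRing.isLinear.Build K _ G *:%R recon recon_linear.

End Recon.

Lemma recon_bij m (G : lieAlgType K) (Y Z : G) :
  lie_codim2 m.+3 G -> good_pair Y Z -> bijective (recon Y Z).
Proof.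
move=> hG gp; apply: linear_bij => [[u [y z]]|x].
  by move/(decompose0 hG gp)=> [/= -> -> ->].
by have [u [y [z ->]]] := decompose hG gp x; exists (u, (y, z)).
Qed.

(** The map is [phi] on the derived ideal and matches the remaining coordinates supplied by [recon].
    It preserves brackets because [lie_coords] involves only the two data that [phi] intertwines. *)
Lemma structure_determined m (G G' : lieAlgType K) (Y Z : G) (Y' Z' : G')
    (phi : {linear subvs_of (derived_alg G) -> subvs_of (derived_alg G')}) :
  lie_codim2 m.+3 G -> good_pair Y Z -> lie_codim2 m.+3 G' -> good_pair Y' Z' ->
  bijective phi -> (forall u, phi (radj Z u) = radj Z' (phi u)) ->
  phi (vsproj (derived_alg G) (lie Z Y)) = vsproj (derived_alg G') (lie Z' Y') ->
  exists f : {linear G -> G'},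
    [/\ lie_isomorphism f, forall u, f (vsval u) = vsval (phi u),
        f Y = Y' & f Z = Z'].
Proof.
move=> hG gp hG' gp' [psi phiK psiK] phi_ad phi_w.
have [g gK Kg] := recon_bij hG gp; have [g' g'K Kg'] := recon_bij hG' gp'.
pose f x := recon Y' Z' (phi (g x).1, (g x).2).
have gL : linear g := can2_linear gK Kg.
have fL : linear f.
  move=> a x x'; rewrite /f gL -linearP; congr (recon _ _ (_, _)).
  by rewrite /= linearP.
pose F : {linear G -> G'} := HB.pack f (GRing.isLinear.Build K G G' *:%R f fL).
have fE u y z : f (vsval u + y *: Y + z *: Z) = vsval (phi u) + y *: Y' + z *: Z'.
  by rewrite /f -[vsval u + _ + _]/(recon Y Z (u, (y, z))) gK.
have fD u : f (vsval u) = vsval (phi u).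
  by have := fE u 0 0; rewrite !scale0r !addr0.
have phiD := linearD phi; have phiB := linearB phi.
have phi0 := linear0 phi.
have phiZ b u : phi (b *: u) = b *: phi u by exact: linearZ.
exists F; split=> //; first split.
- exists (fun x => recon Y Z (psi (g' x).1, (g' x).2)) => x.
    by rewrite /= /f g'K /= phiK -surjective_pairing Kg.
  by rewrite /= /f gK /= psiK -surjective_pairing Kg'.
- move=> x x'; have [u [y [z ->]]] := decompose hG gp x.
  have [u' [y' [z' ->]]] := decompose hG gp x'.
  rewrite /= !fE (lie_coords hG gp) (lie_coords hG' gp').
  have -> : z *: lie Z (vsval u') - z' *: lie Z (vsval u)
      + (z * y' - z' * y) *: lie Z Y
    = vsval (z *: radj Z u' - z' *: radj Z u
      + (z * y' - z' * y) *: vsproj (derived_alg G) (lie Z Y)).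
    by rewrite vsvalD vsvalB !vsvalZ !vsval_radj vsprojK ?lie_derived_alg.
  rewrite fD phiD phiB !phiZ !phi_ad phi_w.
  by rewrite vsvalD vsvalB !vsvalZ !vsval_radj vsprojK ?lie_derived_alg.
- by have := fE 0 1 0; rewrite phi0 !vsval0 !scale0r !scale1r !addr0 !add0r.
- by have := fE 0 0 1; rewrite phi0 !vsval0 !scale0r !scale1r !addr0 !add0r.
Qed.

End Determined.

(** * Classification of the matrix algebras up to isomorphism *)

Section MatrixAlgebras.
Variables (K : fieldType) (m : nat).
Implicit Types A B M : 'M[K]_m.+1.
Local Notation e := (delta_mx ord_max 0 : 'cV[K]_m.+1).

(** Treats both shapes at once: [p] is the zero column, last for [form_ul] and first for
    [form_ur]. *)
Lemma normal_formE M : normal_form M ->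
  exists p (A : 'M[K]_m), A \in unitmx /\ forall i j,
    M i j = if unlift ord_max i is Some i' then
              if unlift p j is Some j' then A i' j' else 0 else 0.
Proof.
by case=> A uA [] ->; [exists ord_max | exists ord0]; exists A; split=> // i j;
  rewrite ?form_ulE ?form_urE.
Qed.

Lemma normal_form_last M (v : 'cV_m.+1) :
  normal_form M -> (M *m v) ord_max 0 = 0.
Proof.
move=> /normal_formE[p [A [_ ME]]]; rewrite mxE big1 // => j _.
by rewrite ME unlift_none mul0r.
Qed.

(** Inverting [A] solves all rows but the last, and the multiple of [e] supplies the last one. *)
Lemma normal_form_span M (x : 'cV_m.+1) :
  normal_form M -> exists v t, x = M *m v + t *: e.
Proof.
move=> /normal_formE[p [A [uA ME]]].
have [y Ay] : exists y, A *m y = \col_i x (lift ord_max i) 0.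
  by exists (invmx A *m \col_i x (lift ord_max i) 0); rewrite mulKVmx.
exists (\col_j if unlift p j is Some j' then y j' 0 else 0), (x ord_max 0).
apply/colP => i; rewrite !mxE (bigD1_ord p) //= ME !mxE unlift_none mulr0 add0r.
case: (unliftP ord_max i) => [i' ->|->]; last first.
  rewrite !eqxx mulr1 big1 ?add0r // => j _.
  by rewrite ME unlift_none mul0r.
rewrite eq_sym (negPf (neq_lift _ _)) mulr0 addr0.
have /colP/(_ i') := Ay; rewrite !mxE => <-; apply: eq_bigr => j _.
by rewrite ME !mxE !liftK.
Qed.

(** For [M = 0] the multiples of [e] alone would fill a space of dimension at least two. *)
Lemma normal_form_neq0 M : (0 < m)%N -> normal_form M -> M != 0.
Proof.
move=> m_gt0 nM; apply/eqP => M0.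
have [v [t]] := normal_form_span (delta_mx (lift ord_max (Ordinal m_gt0)) 0) nM.
rewrite M0 mul0mx add0r => /colP/(_ (lift ord_max (Ordinal m_gt0))).
rewrite !mxE !eqxx [_ == ord_max]eq_sym (negPf (neq_lift _ _)) mulr0 => /eqP.
by rewrite oner_eq0.
Qed.

Lemma prop_similar_isomorphic A B : normal_form A -> normal_form B ->
  prop_similar A B -> lie_isomorphic (mx_lie_alg A) (mx_lie_alg B).
Proof.
move=> nA nB [c [C [c0 uC cA]]].
have BC : B *m C = c *: (C *m A).
  by rewrite scalemxAr cA -!mulmxA mulKVmx.
(* The isomorphism will be [C] on the columns, with [Y] sent to [v + s Y] and [Z] to [Z / c];
   preserving the bracket of [Z] and [Y] means [B v + s e = c C e]. *)
have [v [s vs]] := normal_form_span (c *: (C *m e)) nB.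
(* With [s = 0], the relation [B C = c C A] would put [e] in the image of [A], where last
   coordinates vanish. *)
have s0 : s != 0.
  apply/eqP => s0; move: vs; rewrite s0 scale0r addr0 -[v](mulKVmx uC).
  rewrite (mulmxA B) BC -scalemxAl => /(scalerI c0); rewrite -mulmxA.
  move/(congr1 (mulmx (invmx C))); rewrite !mulKmx // => /colP/(_ ord_max).
  by rewrite normal_form_last // mxE !eqxx => /eqP; rewrite oner_eq0.
have Bv : B *m v = c *: (C *m e) - s *: e by rewrite vs addrK.
pose f (u : mx_lie_alg A) : mx_lie_alg B :=
  (C *m u.1 + (u.2.1 : K) *: v, ((s * u.2.1 : K), (c^-1 * u.2.2 : K))).
have fL : linear f.
  move=> a [x [y z]] [x' [y' z']]; apply: injective_projections.
    apply/colP => i; rewrite /f /= mulmxDr -scalemxAr !mxE.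
    by rewrite -![a *: _]/(a * _); ring.
  by apply: injective_projections; rewrite /f /= -![a *: _]/(a * _); ring.
pose F : {linear mx_lie_alg A -> mx_lie_alg B} :=
  HB.pack f (GRing.isLinear.Build K _ _ *:%R f fL).
exists F; split.
  apply: linear_bij => [[x [y z]] []|[x [y z]]].
    move=> E1 /eqP; rewrite mulf_eq0 (negPf s0) /= => /eqP y0 /eqP.
    rewrite mulf_eq0 invr_eq0 (negPf c0) /= => /eqP z0.
    move: E1; rewrite y0 z0 scale0r addr0 => /(congr1 (mulmx (invmx C))).
    by rewrite mulKmx // mulmx0 => ->.
  exists (invmx C *m (x - (s^-1 * y) *: v), ((s^-1 * y : K), (c * z : K))).
  by rewrite /= /f /= mulKVmx // subrK mulVKf // mulKf.
move=> [x [y z]] [x' [y' z']]; apply: injective_projections; last first.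
  by apply: injective_projections; rewrite /= mulr0.
rewrite /= /f /= scale0r addr0 !mulmxDr -!scalemxAr !mulmxA BC Bv mulmxN.
rewrite -!scalemxAr -!scalemxAl !mulmxA.
move: (C *m A *m x) (C *m A *m x') => a a'.
move: (C *m e) => b; apply/colP => i; rewrite !mxE.
by field.
Qed.

Lemma isomorphic_prop_similar A B : (0 < m)%N -> normal_form A ->
  lie_isomorphic (mx_lie_alg A) (mx_lie_alg B) -> prop_similar A B.
Proof.
move=> m_gt0 nA [f [bf fM]]; have injf := bij_inj bf.
pose i (x : 'cV[K]_m.+1) : mx_lie_alg A := (x, (0, 0)).
(* Every column [x = A v + t e] is a single bracket of [Z] with [v + t Y], so [f] maps it to a
   bracket. *)
have f_derived x : (f (i x)).2 = (0, 0).
  have [v [t ->]] := normal_form_span x nA.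
  have -> : i (A *m v + t *: e) = lie (mxZ A) ((v, (t, 0)) : mx_lie_alg A).
    apply: injective_projections => //=.
    by rewrite scale1r scale0r subr0 mul1r mul0r subr0.
  by rewrite fM.
pose C : 'M[K]_m.+1 := \matrix_(k, j) (f (i (delta_mx j 0))).1 k 0.
have iL : linear i by move=> a x x'; apply: injective_projections;
  rewrite //= scaler0 addr0.
pose I : {linear 'cV[K]_m.+1 -> mx_lie_alg A} :=
  HB.pack i (GRing.isLinear.Build K _ _ *:%R i iL).
have CE x : C *m x = (f (i x)).1.
  rewrite -[i x]/(I x) {2}[x]matrix_sum_delta linear_sum linear_sum.
  rewrite (big_morph fst (id1 := 0) (op1 := +%R)) //.
  apply/colP => k; rewrite mxE summxE; apply: eq_bigr => j _.
  by rewrite big_ord1 !linearZ /= !mxE mulrC.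
have fi x : f (i x) = (C *m x, (0, 0)) by rewrite CE -(f_derived x) -surjective_pairing.
have uC : C \in unitmx.
  rewrite -unitmx_tr -row_free_unit; apply: inj_row_free => v vC.
  apply: trmx_inj; rewrite trmx0.
  have Cv : C *m v^T = 0 by rewrite -[C]trmxK -trmx_mul vC trmx0.
  suff : i v^T = 0 by case.
  by apply: injf; rewrite fi Cv linear0.
(* Only the [Z]-coordinate of [f (mxZ A)] acts on columns, so applying [f] to the bracket of [Z]
   with a column gives [C A = c B C]. *)
pose c : K := (f (mxZ A)).2.2.
have CA : C *m A = c *: (B *m C).
  apply/matrixP => k j; suff /colP/(_ k) : col j (C *m A) = col j (c *: (B *m C)).
    by rewrite !mxE.
  rewrite !colE -mulmxA -scalemxAl -mulmxA; set x := delta_mx j 0.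
  have : i (A *m x) = lie (mxZ A) (i x).
    apply: injective_projections => //=.
    by rewrite scale1r scale0r subr0 mulr0 mul0r subr0 scale0r addr0.
  move/(congr1 f); rewrite fM !fi => -[->].
  by rewrite /= mul0r mulr0 subr0 !scale0r addr0 subr0.
have c0 : c != 0.
  apply: contraNneq (normal_form_neq0 m_gt0 nA) => c0.
  by rewrite -[A](mulKmx uC) CA c0 scale0r mulmx0.
exists c^-1, C; split=> //; first by rewrite invr_eq0.
by rewrite -mulmxA -[A in LHS](mulKmx uC) CA -scalemxAr scalerK.
Qed.

End MatrixAlgebras.

(* Since 4 <= n, matrices and bases of size n - 2 are given size (n - 3).+1. *)
Theorem theorem3p6 (R : realType) (n : nat) (n_ge4 : (4 <= n)%N) :
  (forall (G : lieAlgType R), lie_codim2 n G ->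
    (exists Y Z : G, good_pair Y Z) /\
    (forall Y Z : G, good_pair Y Z ->
      (* (1) *)
      (lie Y Z = 0 \/ nonsingular (radj Z) ->
        decomposable G /\
        exists Gb : subalgebra G,
          [/\ \dim Gb = (n - 1)%N, lie_solvable Gb,
              \dim (derived Gb) = (n - 2)%N, derived Gb = derived_alg G
            & lie_isomorphic G (R^o * subvs_of Gb)%type]) /\
      (* (2) *)
      (lie Y Z <> 0 -> ~ nonsingular (radj Z) ->
        [/\ ~ decomposable G,
            (* the structure is determined by [Z, Y] and a_Z *)
            (forall (G' : lieAlgType R) (Y' Z' : G')
                (phi : {linear subvs_of (derived_alg G)
                          -> subvs_of (derived_alg G')}),
              lie_codim2 n G' -> good_pair Y' Z' -> bijective phi ->
              (forall u, phi (radj Z u) = radj Z' (phi u)) ->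
              phi (vsproj (derived_alg G) (lie Z Y))
                = vsproj (derived_alg G') (lie Z' Y') ->
              exists f : {linear G -> G'},
                [/\ lie_isomorphism f,
                    forall u, f (vsval u) = vsval (phi u),
                    f Y = Y' & f Z = Z']),
            \dim (limg (radj Z)) = (n - 3)%N
          & (* Y may have to be translated by an element of the derived ideal *)
            exists (Y' : G) (X : (n - 3).+1.-tuple G),
              [/\ Y' - Y \in derived_alg G, good_pair Y' Z,
                  basis_of (derived_alg G) X,
                  lie Z Y' = tnth X ord_max
                & normal_form (ad_matrix X Z)]]))) /\
  (forall Ab Bb : 'M[R]_((n - 3).+1),
    normal_form Ab -> normal_form Bb ->
    (lie_isomorphic (mx_lie_alg Ab) (mx_lie_alg Bb) <-> prop_similar Ab Bb)).
Proof.
(* Setting [n = m.+3] removes all truncated subtractions and turns [4 <= n] into [0 < m]. *)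
have [m m_gt0 nE] : exists2 m, (0 < m)%N & n = m.+3.
  by exists (n - 3)%N; rewrite ?subn_gt0 // -addn3 subnK // ltnW.
have n1E : (n - 1 = m.+2)%N by rewrite nE subn1.
have n2E : (n - 2 = m.+1)%N by rewrite nE subn2.
have n3E : (n - 3 = m)%N by rewrite nE !subSS subn0.
rewrite n1E n2E n3E nE => {n n_ge4 nE n1E n2E n3E}.
split=> [G hG|A B nA nB]; last first.
  split; first exact: isomorphic_prop_similar.
  exact: prop_similar_isomorphic.
split; first exact: good_pair_exists hG.
move=> Y Z gp; split=> [YZ|YZ sing].
  (* Both alternatives yield a translate of [Y] commuting with [Z]: [u = 0] if [lie Y Z = 0], and a
     preimage of [lie Z Y] under [radj Z] in the non-singular case. *)
  suff [u uD Yu] : exists2 u, u \in derived_alg G & lie Z (Y - u) = 0.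
    exact: (split_case hG (good_pair_translate hG gp uD) Yu).
  case: YZ => [YZ0|ns]; last exact: nonsingular_split ns.
  by exists 0; rewrite ?mem0v // subr0 lieNC YZ0 oppr0.
split.
- exact: (singular_indecomposable hG gp sing).
- move=> G' Y' Z' phi hG' gp'.
  exact: (structure_determined hG gp hG' gp').
- exact: singular_dim_limg (dim_subvs_derived hG) (limg_radj_line hG gp) sing.
- exact: (singular_normal_basis hG gp sing).
Qed.
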